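(* Let $q,n\in\mathbb{N}$ and $f,g\in\mathbb{X}_q$. Suppose that $s:=\mathrm{ord}(f)$ and $m:=\mathrm{ord}(g)$ are finite, $s>0$, and $s=mn$. Then $g$ is an $n$-th root of $f$ if and only if all of the following equations are satisfied: (i) for every $c\in C_{mn}$, $$f_c=\sum_{\substack{(c^1,\ldots,c^n)\in (C_m)^n\\ c^1+\cdots+c^n=c}} g_{c^1}\cdots g_{c^n};$$ (ii) $[f]_{mn+1}=H^{m}\,[g]_{m+1}$; (iii) for every $k\in\mathbb{N}$, $$[f]_{mn+k}=G^{m+k-1}+H^{m+k-1}\,[g]_{m+k}.$$
   Context: $\mathbb{N}$ is the set of positive integers, $\mathbb{N}_0=\mathbb{N}\cup\{0\}$, and $\mathbb{K}$ is the field $\mathbb{R}$ or $\mathbb{C}$. For $q\in\mathbb{N}$ put $C:=\mathbb{N}_0^q$. A formal power series of $q$ variables over $\mathbb{K}$ ($q$-fps) is a function $f:C\to\mathbb{K}$, with coefficients $f_c:=f(c)$, written $f(x)=\sum_{c\in C}f_cX^c$, where $X^c=x_1^{c_1}\cdots x_q^{c_q}$; $\mathbb{X}_q$ is the set of all $q$-fps. The product of $f,g\in\mathbb{X}_q$ is the Cauchy product $(fg)_c=\sum_{a,b\in C,\ a+b=c}f_ag_b$. An $n$-th root of $f\in\mathbb{X}_q$ is any $g\in\mathbb{X}_q$ with $g^n=f$ ($n$-fold Cauchy product). For $k\in\mathbb{N}_0$ let $C_k:=\{c\in C: c_1+\cdots+c_q=k\}$, a set with $r(k):=\binom{k+q-1}{q-1}$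 elements, and fix an enumeration $C_k=\{c^k_1,\ldots,c^k_{r(k)}\}$. The order of $f$ is $\mathrm{ord}(f):=\inf\{k\in\mathbb{N}_0:\ f_c\neq 0\text{ for some }c\in C_k\}$, with $\inf\emptyset=+\infty$. Conventions: for a set $S$ and $n\in\mathbb{N}$, $S^n$ (also written $(S)^n$) is the cartesian product of $n$ copies of $S$, and $S^0:=\emptyset$; a sum over the empty set equals $0$. For $u\in\mathbb{X}_q$ and $l\in\mathbb{N}_0$, $[u]_l$ denotes the column vector $[u]_l:=[u_{c^l_1}\ \ldots\ u_{c^l_{r(l)}}]^T$. Given $g\in\mathbb{X}_q$, $n\in\mathbb{N}$, $m=\mathrm{ord}(g)\in\mathbb{N}_0$ and $k\in\mathbb{N}$: - For $c\in C_{mn+k}$ put $$G^{m+k-1}_c:=\sum_{\substack{(c^1,\ldots,c^n)\in (C_m\cup\cdots\cup C_{m+k-1})^n\\ c^1+\cdots+c^n=c}} g_{c^1}\cdots g_{c^n},$$ and let $G^{m+k-1}:=[G^{m+k-1}_{c^{mn+k}_1}\ \ldots\ G^{m+k-1}_{c^{mn+k}_{r(mn+k)}}]^T$. - $H^{m+k-1}$ is the $r(mn+k)\times r(m+k)$ matrix whose $(i,j)$ entry is $$h^{m+k-1}_{ij}:=\sum_{\substack{(c^1,\ldots,c^{n-1})\in (C_m)^{n-1}\\ c^1+\cdots+c^{n-1}=c^{mn+k}_i-c^{m+k}_j}} n\,g_{c^1}\cdots g_{c^{n-1}},$$ for $1\le i\le r(mn+k)$, $1\le j\le r(m+k)$.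 (In particular $H^m$ is the case $k=1$.)
   Formalization: For n = 1 the sum defining H is taken over one empty tuple (empty product 1), so H is the identity; with the stated convention S^0 := ∅, H would be 0 and the claim would fail, e.g. for q = n = 1, f = g = X + X^2. *)

(* Defs.v *)
From mathcomp Require Export all_boot all_order all_algebra.
From mathcomp Require Export boolp reals.
From mathcomp.real_closed Require Export complex.
From mathcomp Require Export mpoly.

Set Implicit Arguments.
Unset Strict Implicit.
Unset Printing Implicit Defensive.

Import GRing.Theory.
Local Open Scope ring_scope.

Definition is_real_or_complex_field (R : realType) (K : fieldType) : Prop :=
  K = (R : fieldType) \/ K = (R[i] : fieldType).

(* The type ['X_{1..q}] of exponent vectors is N_0^q and [mdeg c] is
   c_1 + ... + c_q. *)
Definition fps (K : fieldType) (q : nat) : Type := 'X_{1..q} -> K.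

Section FormalPowerSeries.
Context {K : fieldType} {q : nat}.
Implicit Types (f g u : fps K q) (c : 'X_{1..q}).

Definition fps_one : fps K q := fun c => (c == 0%MM)%:R.

(* If a + b = c then a and b have degree at most [mdeg c], so the bound on the
   summation index, needed only to make it finite, loses no pair. *)
Definition fps_mul f g : fps K q := fun c =>
  \sum_(ab : 'X_{1..q < (mdeg c).+1, (mdeg c).+1} | c == (ab.1 + ab.2)%MM)
     f ab.1 * g ab.2.

Definition fps_exp g (n : nat) : fps K q := iterop n fps_mul g fps_one.

Definition is_nth_root (n : nat) g f : Prop := fps_exp g n = f.

Definition has_term_of_degree f (k : nat) : bool :=
  [exists c : 'X_{1..q < k.+1}, (mdeg c == k) && (f c != 0)].

(* [None] stands for +oo. *)
Definition fps_ord f : option nat :=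
  match pselect (exists k, has_term_of_degree f k) with
  | left ex => Some (ex_minn ex)
  | right _ => None
  end.

End FormalPowerSeries.

(* The number of exponent vectors of degree k, for q > 0. *)
Definition numdeg (q k : nat) : nat := 'C(k + q - 1, q - 1).

(* [e k] lists without repetition the exponent vectors of degree k. *)
Definition is_degree_enum (q : nat)
    (e : forall k, 'I_(numdeg q k) -> 'X_{1..q}) : Prop :=
  forall k, injective (e k) /\
    (forall c : 'X_{1..q}, mdeg c = k <-> exists i, e k i = c).

Lemma degree_enum_exists (q : nat) : (0 < q)%N ->
  exists e : forall k, 'I_(numdeg q k) -> 'X_{1..q}, is_degree_enum e.
Proof.
case: q => // n _.
pose b d := [seq s2m t | t : d.-tuple 'I_n.+1 <- enum (basis n.+1 d)].
have size_b d : size (b d) = numdeg n.+1 d.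
  by rewrite size_basis /numdeg addnS !subn1 /= -bin_sub ?leq_addr // addKn.
exists (fun k (i : 'I_(numdeg n.+1 k)) => nth 0%MM (b k) i) => k; split.
  move=> i j /eqP; rewrite nth_uniq ?size_b ?ltn_ord ?uniq_basis //.
  by move/eqP/val_inj.
move=> c; split=> [/eqP|[i <-]].
  rewrite basis_cover => c_b; have := c_b; rewrite -index_mem size_b => lt_i.
  by exists (Ordinal lt_i); rewrite /= nth_index.
by apply/eqP; rewrite basis_cover mem_nth ?size_b.
Qed.

Section RootEquations.
Context {K : fieldType} {q : nat}.
Context (e : forall k, 'I_(numdeg q k) -> 'X_{1..q}).
Implicit Types (f g u : fps K q) (c : 'X_{1..q}).

Definition coef_col u (l : nat) : 'cV[K]_(numdeg q l) := \col_i u (e i).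

(* Tuples (c^1, ..., c^n) of exponent vectors are finite functions t on 'I_n. *)
Definition lowest_coef g (n m : nat) c : K :=
  \sum_(t : {ffun 'I_n -> 'X_{1..q < m.+1}} |
          [forall i, mdeg (t i) == m] && ((\sum_i t i)%MM == c))
     \prod_i g (t i).

(* The condition m <= mdeg (t i) < m + k says that t i lies in the union of
   C_m, ..., C_(m+k-1); the upper bound is built into the type of t. *)
Definition G_coef g (n m k : nat) c : K :=
  \sum_(t : {ffun 'I_n -> 'X_{1..q < m + k}} |
          [forall i, m <= mdeg (t i)]%N && ((\sum_i t i)%MM == c))
     \prod_i g (t i).

(* G^{m+k-1} *)
Definition G_col g (n m k : nat) : 'cV[K]_(numdeg q (m * n + k)) :=
  \col_i G_coef g n m k (e i).

(* H^{m+k-1}.  The difference of the i-th and j-th exponent vectors may have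
   negative entries, in which case there is no tuple to sum over; subtraction
   of exponent vectors being truncated, the condition is written additively.
   For n = 1 there is exactly one, empty, tuple, with sum 0 and product 1, so
   that H is then the identity matrix. *)
Definition H_mx g (n m k : nat) :
    'M[K]_(numdeg q (m * n + k), numdeg q (m + k)) :=
  \matrix_(i, j)
    \sum_(t : {ffun 'I_n.-1 -> 'X_{1..q < m.+1}} |
            [forall l, mdeg (t l) == m] && (((\sum_l t l) + e j)%MM == e i))
       n%:R * \prod_l g (t l).

End RootEquations.

(* Main.v *)
(** Truncate [g] to a polynomial.  Up to terms of degree above [m * n + k], the
    polynomial may be taken to be [A + B], where [A] carries the degrees in
    [[m, m + k)] and [B] the degree [m + k]; its [n]-th power is then
    [A ^+ n + n A ^+ n.-1 B], and in the second summand only the part of [A] of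
    degree [m] matters.  These two summands are [G] and [H [g]]. *)
Require Import Defs.
From mathcomp Require Import zify ring.

Set Implicit Arguments.
Unset Strict Implicit.
Unset Printing Implicit Defensive.

Import GRing.Theory.
Local Open Scope ring_scope.

(** The second-order remainder of the binomial expansion satisfies a recursion in the exponent,
    which drives the induction in [vanishes_below_expD]. *)
Lemma expD_remainderS (R : comNzRingType) (a b : R) n :
  (a + b) ^+ n.+2 - a ^+ n.+2 - (a ^+ n.+1 * b) *+ n.+2 =
    (a + b) * ((a + b) ^+ n.+1 - a ^+ n.+1 - (a ^+ n * b) *+ n.+1)
    + (a ^+ n * (b * b)) *+ n.+1.
Proof. by rewrite !exprS -(mulr_natr _ n.+2) -2!(mulr_natr _ n.+1); ring. Qed.

(** * Degree filtration of the polynomial ring *)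

Section VanishingBelow.
Context {K : fieldType} {q : nat}.
Implicit Types (p u v a b : {mpoly K[q]}) (d k n : nat).

Definition vanishes_below p d : Prop :=
  forall c, (mdeg c < d)%N -> p@_c = 0.

Lemma vanishes_below0 d : vanishes_below 0 d.
Proof. by move=> c _; rewrite mcoeff0. Qed.

Lemma vanishes_below_leq d' p d :
  (d <= d')%N -> vanishes_below p d' -> vanishes_below p d.
Proof. by move=> le_d p0 c lt_c; apply/p0/(leq_trans lt_c). Qed.

Lemma vanishes_belowD u v d :
  vanishes_below u d -> vanishes_below v d -> vanishes_below (u + v) d.
Proof. by move=> u0 v0 c lt_c; rewrite mcoeffD u0 ?v0 ?addr0. Qed.

Lemma vanishes_belowMn u d n : vanishes_below u d -> vanishes_below (u *+ n) d.
Proof. by move=> u0 c lt_c; rewrite mcoeffMn u0 ?mul0rn. Qed.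

Lemma vanishes_belowM u v d k :
  vanishes_below u d -> vanishes_below v k -> vanishes_below (u * v) (d + k).
Proof.
move=> u0 v0 c lt_c; rewrite mcoeffM big1 // => -[x y] /= /eqP c_xy.
have lt_xy := lt_c; rewrite {1}c_xy mdegD in lt_xy.
have [lt_x|le_x] := ltnP (mdeg x) d; first by rewrite u0 ?mul0r.
rewrite v0 ?mulr0 // -(ltn_add2l d); apply: leq_ltn_trans lt_xy.
by rewrite leq_add2r.
Qed.

Lemma vanishes_belowX u d n :
  vanishes_below u d -> vanishes_below (u ^+ n) (d * n).
Proof.
move=> u0; elim: n => [|n IHn]; first by rewrite muln0.
by rewrite exprS mulnS; apply: vanishes_belowM.
Qed.

(** For [n > 0] the difference is a sum of products of one factor [u - v] and [n - 1] factors [u] or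
    [v], so the orders add up to at least [(d + k) + d * (n - 1)]. *)
Lemma vanishes_below_subX u v d k n :
    vanishes_below u d -> vanishes_below v d ->
    vanishes_below (u - v) (d + k) ->
  vanishes_below (u ^+ n - v ^+ n) (d * n + k).
Proof.
move=> u0 v0 uv0; elim: n => [|n IHn].
  by rewrite subrr; apply: vanishes_below0.
have -> : u ^+ n.+1 - v ^+ n.+1 = u * (u ^+ n - v ^+ n) + (u - v) * v ^+ n.
  by rewrite mulrBr mulrBl -!exprS addrA subrK.
apply: vanishes_belowD; first by rewrite mulnS -addnA; apply: vanishes_belowM.
by rewrite mulnS addnAC; apply/vanishes_belowM/vanishes_belowX.
Qed.

(** Every term of the remainder has at least two factors [b] among its [n + 1], and each of them
    raises the order by [k]. *)
Lemma vanishes_below_expD a b d k n :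
    vanishes_below a d -> vanishes_below b (d + k) ->
  vanishes_below ((a + b) ^+ n.+1 - a ^+ n.+1 - (a ^+ n * b) *+ n.+1)
                 (d * n.+1 + k + k).
Proof.
move=> a0 b0; have ab0 : vanishes_below (a + b) d.
  by apply: vanishes_belowD => //; apply: vanishes_below_leq b0; apply: leq_addr.
elim: n => [|n IHn].
  rewrite !expr1 expr0 mul1r mulr1n addrAC addrK subrr.
  exact: vanishes_below0.
rewrite expD_remainderS.
apply: vanishes_belowD.
  rewrite mulnS -!addnA; apply: vanishes_belowM => //.
  by rewrite addnA.
apply: vanishes_belowMn.
have -> : (d * n.+2 + k + k = d * n + ((d + k) + (d + k)))%N.
  by rewrite !mulnS; lia.
by apply: vanishes_belowM; [apply: vanishes_belowX | apply: vanishes_belowM].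
Qed.

End VanishingBelow.

(** * Polynomial truncations of power series *)

Section Slices.
Context {K : fieldType} {q : nat}.
Implicit Types (f g : fps K q) (c : 'X_{1..q}).

(** A polynomial rather than a power series, so that the ring laws of [{mpoly K[q]}] apply. *)
Definition slice g (a b : nat) : {mpoly K[q]} :=
  \sum_(c : 'X_{1..q < b} | (a <= mdeg c)%N) g c *: 'X_[c].

Lemma mcoeff_slice g a b c :
  (slice g a b)@_c = if (a <= mdeg c < b)%N then g c else 0.
Proof.
rewrite raddf_sum /=; under eq_bigr do rewrite mcoeffZ mcoeffX.
case: ifPn => [/andP[le_c lt_c]|nc].
  rewrite (bigD1 (BMultinom lt_c)) //= eqxx mulr1 big1 ?addr0 // => x.
  by case/andP=> _ /negPf; rewrite -val_eqE /= => ->; rewrite mulr0.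
rewrite big1 // => x le_x; case: eqP => [xc|]; last by rewrite mulr0.
by move: nc; rewrite -xc le_x bmdeg.
Qed.

Lemma vanishes_below_slice g a b : vanishes_below (slice g a b) a.
Proof. by move=> c lt_c; rewrite mcoeff_slice leqNgt lt_c. Qed.

Lemma slice_exp g a b n :
  slice g a b ^+ n =
  \sum_(t : {ffun 'I_n -> 'X_{1..q < b}} | [forall i, (a <= mdeg (t i))%N])
     (\prod_i g (t i)) *: 'X_[\sum_i t i].
Proof.
have -> : slice g a b ^+ n = \prod_(i < n) slice g a b.
  by rewrite prodr_const card_ord.
rewrite bigA_distr_big /=; apply: eq_big => [t|t _].
  by apply/forallP/forallP => t_a i; have := t_a i.
by rewrite scaler_prod mprodXE.
Qed.

(** Distributivity produces exactly the sums over tuples in [G_coef] and, for [b = a + 1], in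
    [lowest_coef]. *)
Lemma mcoeff_sliceX g a b n c :
  (slice g a b ^+ n)@_c =
  \sum_(t : {ffun 'I_n -> 'X_{1..q < b}} |
          [forall i, (a <= mdeg (t i))%N] && ((\sum_i t i)%MM == c))
     \prod_i g (t i).
Proof.
rewrite slice_exp raddf_sum /= [RHS]big_mkcondr; apply: eq_bigr => t _.
by rewrite mcoeffZ mcoeffX; case: eqP => _; rewrite ?mulr1 ?mulr0.
Qed.

Lemma fps_exp_slice g n N c : (0 < n)%N -> (mdeg c < N)%N ->
  fps_exp g n c = (slice g 0 N ^+ n)@_c.
Proof.
(* [iterop] returns [g] itself at exponent 1 and then multiplies by [g] on the left, so the
   induction starts at 1. *)
case: n => // n _; elim: n c => [|n IHn] c lt_c.
  by rewrite expr1 mcoeff_slice lt_c.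
(* [fps_mul] and [mcoeffM] sum over the same pairs, whose members have degree at most [mdeg c < N],
   where truncation changes nothing. *)
rewrite exprS mcoeffM; apply: eq_bigr => -[x y] /= /eqP c_xy.
have lt_xy := lt_c; rewrite {1}c_xy mdegD in lt_xy.
rewrite mcoeff_slice (leq_ltn_trans (leq_addr _ _) lt_xy) -IHn //.
exact: leq_ltn_trans (leq_addl _ _) lt_xy.
Qed.

Lemma fps_ord_lt f s c : fps_ord f = Some s -> (mdeg c < s)%N -> f c = 0.
Proof.
rewrite /fps_ord; case: pselect => // ex [<-].
case: ex_minnP => d _ d_min lt_c; apply/eqP; apply: contraTT lt_c => fc.
rewrite -leqNgt; apply: d_min; apply/existsP.
by exists (BMultinom (ltnSn (mdeg c))); rewrite /= eqxx.
Qed.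

End Slices.

(** * Coefficients of the [n]-th power, degree by degree *)

Section RootCoefficients.
Context {K : fieldType} {q : nat}.
Context (e : forall k, 'I_(numdeg q k) -> 'X_{1..q}) (he : is_degree_enum e).
Context (g : fps K q) (n m : nat).
Implicit Types c : 'X_{1..q}.

Lemma mdeg_enum k i : mdeg (@e k i) = k.
Proof. by apply/(proj2 (he k)); exists i. Qed.

Lemma slice_enum d :
  slice g d d.+1 = \sum_(j < numdeg q d) g (e j) *: 'X_[e j].
Proof.
apply/mpolyP => c; rewrite mcoeff_slice ltnS -eqn_leq raddf_sum /=.
under eq_bigr do rewrite mcoeffZ mcoeffX.
case: eqP => [d_c|ne_c]; last first.
  rewrite big1 // => j _; case: eqP => [jc|]; last by rewrite mulr0.
  by case: ne_c; rewrite -jc mdeg_enum.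
have [j jc] := proj1 (proj2 (he d) c) (esym d_c).
rewrite (bigD1 j) //= jc eqxx mulr1 big1 ?addr0 // => i ne_ij.
case: eqP => [ic|]; last by rewrite mulr0.
by case/eqP: ne_ij; apply: (proj1 (he d)); rewrite ic.
Qed.

Lemma slice_deg_cond d n' (t : {ffun 'I_n' -> 'X_{1..q < d.+1}}) :
  [forall i, mdeg (t i) == d] = [forall i, (d <= mdeg (t i))%N].
Proof. by apply: eq_forallb => i; rewrite eqn_leq -ltnS bmdeg. Qed.

Lemma lowest_coef_slice c : lowest_coef g n m c = (slice g m m.+1 ^+ n)@_c.
Proof.
by rewrite mcoeff_sliceX; apply: eq_bigl => t; rewrite slice_deg_cond.
Qed.

(** The column ranges over the one factor of degree [m + k], the matrix over the [n - 1] factors of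
    degree [m], and the scalar [n] counts the positions of the former. *)
Lemma H_mx_slice k i :
  (H_mx e g n m k *m coef_col e g (m + k)) i 0 =
  ((slice g m m.+1 ^+ n.-1 * slice g (m + k) (m + k).+1) *+ n)@_(e i).
Proof.
rewrite mcoeffMn (slice_enum (m + k)) mulr_sumr raddf_sum /= -sumrMnl mxE.
apply: eq_bigr => j _; rewrite !mxE -scalerAr mcoeffZ -mulrnAr mulrC.
rewrite -big_distrr /= mulr_natl; congr (_ * (_ *+ _)).
rewrite slice_exp mulr_suml raddf_sum /= big_mkcondr.
apply: eq_big => [t|t _]; first exact: slice_deg_cond.
rewrite -scalerAl -mpolyXD mcoeffZ mcoeffX.
by case: eqP => _; rewrite ?mulr1 ?mulr0.
Qed.

(** For [k = 1] all [n] exponents have degree exactly [m] and cannot add up to degree [m * n + 1];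
    this is why (ii) has no [G]. *)
Lemma G_coef1 c : mdeg c = (m * n + 1)%N -> G_coef g n m 1 c = 0.
Proof.
move=> deg_c; rewrite /G_coef big1 // => t /andP[/forallP t_m /eqP t_c].
have : (m * n + 1 = m * n)%N; last by lia.
rewrite -deg_c -t_c mdeg_sum (eq_bigr (fun=> m)).
  by rewrite sum_nat_const card_ord mulnC.
by move=> i _; move: (bmdeg (t i)) (t_m i); move: (mdeg _) => d; lia.
Qed.

Hypotheses (n_gt0 : (0 < n)%N) (hm : fps_ord g = Some m).

Lemma vanishes_below_truncation N : vanishes_below (slice g 0 N) m.
Proof.
by move=> c lt_c; rewrite mcoeff_slice (fps_ord_lt hm lt_c) if_same.
Qed.


(** A term of [g] of degree at least [m + k] is multiplied by [n - 1] factors of degree at least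
    [m], hence shows only from degree [m * n + k] on. *)
Lemma fps_exp_slice_lt k c : (0 < k)%N -> (mdeg c < m * n + k)%N ->
  fps_exp g n c = (slice g m (m + k) ^+ n)@_c.
Proof.
move=> k_gt0 lt_c.
have le_N : (m + k <= m * n + k)%N by rewrite leq_add2r leq_pmulr.
rewrite (fps_exp_slice _ n_gt0 lt_c); apply/eqP; rewrite -subr_eq0 -mcoeffB.
apply/eqP; apply: vanishes_below_subX lt_c.
- exact: vanishes_below_truncation.
- exact: vanishes_below_slice.
move=> d lt_d; rewrite mcoeffB !mcoeff_slice lt_d (leq_trans lt_d le_N) andbT /=.
by case: leqP => [_|/(fps_ord_lt hm) ->]; rewrite subrr.
Qed.

Lemma fps_exp_lt c : (mdeg c < m * n)%N -> fps_exp g n c = 0.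
Proof.
move=> lt_c; rewrite (@fps_exp_slice_lt 1) //; last by rewrite addn1 ltnW.
exact: (vanishes_belowX (@vanishes_below_slice _ _ g m _)).
Qed.

Lemma fps_exp_lowest c : mdeg c = (m * n)%N ->
  fps_exp g n c = lowest_coef g n m c.
Proof.
move=> deg_c; rewrite (@fps_exp_slice_lt 1) ?deg_c ?addn1 //.
by rewrite lowest_coef_slice.
Qed.

Lemma slice_recr k :
  slice g m (m + k).+1 = slice g m (m + k) + slice g (m + k) (m + k).+1.
Proof.
apply/mpolyP => c; rewrite mcoeffD !mcoeff_slice ltnS.
case: (ltngtP (mdeg c) (m + k)) => [lt_c|lt_c|->].
- by rewrite andbT addr0.
- by rewrite !andbF addr0.
by rewrite leq_addr /= add0r.
Qed.

Lemma coef_col_fps_exp k : (0 < k)%N ->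
  coef_col e (fps_exp g n) (m * n + k) =
  G_col e g n m k + H_mx e g n m k *m coef_col e g (m + k).
Proof.
move=> k_gt0; apply/matrixP => i j; rewrite ord1 {j} [RHS]mxE H_mx_slice !mxE.
rewrite /G_coef -mcoeff_sliceX; set c := e i.
have deg_c : mdeg c = (m * n + k)%N by apply: mdeg_enum.
(* Truncating below [m + k] would settle only degrees below [m * n + k], so degree [m + k] is kept
   as well. *)
rewrite (@fps_exp_slice_lt k.+1) ?deg_c ?addnS // slice_recr.
have A0 := @vanishes_below_slice _ _ g m (m + k).
have L0 := @vanishes_below_slice _ _ g m m.+1.
have B0 := @vanishes_below_slice _ _ g (m + k) (m + k).+1.
(* As [k > 0], both slices contain the degree [m] part of [g], which cancels. *)
have AL0 : vanishes_below (slice g m (m + k) - slice g m m.+1) (m + 1).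
  rewrite addn1 => d; rewrite ltnS leq_eqVlt => /orP[/eqP d_m|lt_d].
    rewrite mcoeffB !mcoeff_slice d_m leqnn ltnSn /= -addn1 leq_add2l k_gt0.
    exact: subrr.
  by rewrite mcoeffB A0 ?L0 ?subrr.
move: A0 L0 B0 AL0 deg_c.
move: (slice g m (m + k)) (slice g m m.+1) (slice g (m + k) _).
move=> A L B A0 L0 B0 AL0 deg_c.
case: n n_gt0 deg_c => // n' _ deg_c /=.
(* The terms with two factors [B] start in degree [m * n + 2 * k], beyond [c] because [k > 0]. *)
have lt_c : (mdeg c < m * n'.+1 + k + k)%N by rewrite deg_c; lia.
have /eqP := vanishes_below_expD A0 B0 lt_c.
(* Replacing [A] by [L] next to [B] costs only terms of degree at least [m * n + k + 1]. *)
have lt_c' : (mdeg c < m * n' + 1 + (m + k))%N by rewrite deg_c mulnS; lia.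
have /eqP := vanishes_belowM (vanishes_below_subX (n := n') A0 L0 AL0) B0 lt_c'.
rewrite mulrBl !mcoeffB !subr_eq0 => /eqP E.
by rewrite mcoeffMn E subr_eq mcoeffMn addrC => /eqP.
Qed.

End RootCoefficients.

Theorem theorem12 (R : realType) (K : fieldType)
    (hK : is_real_or_complex_field R K)
    (q n : nat) (hq : (0 < q)%N) (hn : (0 < n)%N)
    (e : forall k : nat, 'I_(numdeg q k) -> 'X_{1..q})
    (he : is_degree_enum e)
    (f g : fps K q) (s m : nat)
    (hs : fps_ord f = Some s) (hm : fps_ord g = Some m)
    (s_gt0 : (0 < s)%N) (hsmn : s = (m * n)%N) :
  is_nth_root n g f <->
  [/\ forall c : 'X_{1..q}, mdeg c = (m * n)%N -> f c = lowest_coef g n m c,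
      coef_col e f (m * n + 1) = H_mx e g n m 1 *m coef_col e g (m + 1)
    & forall k : nat, (0 < k)%N ->
        coef_col e f (m * n + k)
        = G_col e g n m k + H_mx e g n m k *m coef_col e g (m + k)].
Proof.
have rootE := coef_col_fps_exp he hn hm.
split=> [<-|[f_low _ f_col]].
  split=> // [c|]; first exact: fps_exp_lowest.
  (* Equation (ii) is the case [k = 1], where the column [G] vanishes. *)
  rewrite rootE // [G_col _ _ _ _ _](_ : _ = 0) ?add0r //.
  by apply/matrixP => i j; rewrite !mxE G_coef1 ?mdeg_enum.
(* Below degree [m * n], the order of [f], both sides vanish; (iii) settles the degrees above it and
   (i) the degree itself. *)
apply/funext => c; case: (ltngtP (mdeg c) (m * n)) => [lt_c|lt_c|deg_c].
- by rewrite (fps_exp_lt hn hm) // (fps_ord_lt hs) ?hsmn.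
- have k_gt0 : (0 < mdeg c - m * n)%N by rewrite subn_gt0.
  have deg_c : mdeg c = (m * n + (mdeg c - m * n))%N by rewrite subnKC // ltnW.
  have [i <-] := proj1 (proj2 (he _) c) deg_c.
  have := rootE _ k_gt0; rewrite -f_col // => /matrixP/(_ i 0).
  by rewrite !mxE.
by rewrite (fps_exp_lowest hn hm) // f_low.
Qed.
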